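(* Let $p$ be a prime, let $R$ be a DS-extension of a ring $Q$ and suppose that $Q$ is an $\mathbb{F}_p$-algebra. Then the topological Hopf $R$-algebra $\hat{\mathcal{A}}\hat{\otimes}R\cong\mathrm{Hom}_{\mathbb{F}_p}(P,R)$ has a dense Hopf $R$-subalgebra isomorphic to the group algebra $R[P(Q)]$.
   Context: DS-extension: let $Q$ be a subring of a commutative ring $R$ with no zero divisors. $R$ is a DS-extension of $Q$ if there exists an infinite sequence of elements $q_i\in Q$, $i=1,2,\ldots$, such that all differences $q_i-q_j$ with $i\ne j$ are invertible in $R$. $\mathbb{F}_p$ is the prime field with $p$ elements. For a commutative $\mathbb{F}_p$-algebra $B$, $P(B)$ is the group, under composition, of formal power series of the form $\sum_{i=0}^\infty a_ix^{p^i}$ with $a_i\in B$ and $a_0=1$. The functor $B\mapsto P(B)$ is represented by the Hopf algebra $P$ over $\mathbb{F}_p$, which as an algebra is $\mathbb{F}_p[x_1,x_2,\ldots]$, with diagonal $\Delta(x_n)=x_n\otimes1+1\otimes x_n+\sum_{k=1}^{n-1}x_k\otimes x_{n-k}^{p^k}$. $\hat{\mathcal{A}}$ is the (ungraded) $\mathbb{F}_p$-dual $\mathrm{Hom}_{\mathbb{F}_p}(P,\mathbb{F}_p)$ of $P$, a topological Hopf algebra over $\mathbb{F}_p$ with the linear topology whose fundamental neighborhoods of $0$ are the annihilators of finite-dimensional subspaces of $P$. (It is the ungraded version of the graded dual $\mathcal A$ of $P$, which is the Steenrod algebra for $p=2$ and the algebra of reduced powers for $p$ odd.) $\hat{\mathcal{A}}\hat\otimes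 R$ is the completed tensor product over $\mathbb F_p$; it is identified with $\mathrm{Hom}_{\mathbb{F}_p}(P,R)=\mathrm{Hom}_R(P\otimes R,R)$, with fundamental neighborhoods of $0$ the annihilators of free finite rank $R$-submodules of $P\otimes R$. Its product is convolution, dual to $\Delta$ (that is, $(fg)(a)=(f\otimes g)(\Delta a)$ followed by multiplication in $R$), and its continuous coproduct $\mathrm{Hom}_{\mathbb F_p}(P,R)\to \mathrm{Hom}_{\mathbb F_p}(P\otimes P,R)$, with values in the completed tensor square, is dual to the multiplication of $P$. The group algebra $R[P(Q)]$ carries its usual Hopf algebra structure over $R$, in which group elements are grouplike. The assertion is that there is an injective $R$-linear map $R[P(Q)]\to\mathrm{Hom}_{\mathbb F_p}(P,R)$ compatible with the Hopf algebra structures and with dense image. *)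

(* Defs.v *)
From HB Require Import structures.
From mathcomp Require Import all_boot all_algebra all_field finmap.
From mathcomp Require Import all_classical.
From mathcomp Require Import topology_structure.
From mathcomp Require Import monalg.

Set Implicit Arguments.
Unset Strict Implicit.
Unset Printing Implicit Defensive.

Import GRing.Theory.
Local Open Scope classical_set_scope.
Local Open Scope ring_scope.

Section DSExtension.
Variables (R : idomainType) (S : {pred R}) (Q : GRing.SubComNzRing.type S).

Definition DS_extension : Prop :=
  exists q : nat -> Q,
    forall i j, i != j -> (val (q i) - val (q j)) \is a GRing.unit.

Lemma pchar_ambient p : p \in [pchar Q] -> p \in [pchar R].
Proof. exact: (rmorph_pchar (val : {rmorphism Q -> R})). Qed.

End DSExtension.

Section PSeries.
Variables (p : nat) (B : comNzRingType).

(* A formal power series is its sequence of coefficients. The coefficient of  *)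
(* x^n in f(g(x)), for g without constant term, depends only on the           *)
(* coefficients of f and g up to n.                                           *)
Definition series_comp (f g : nat -> B) : nat -> B :=
  fun n => ((\poly_(i < n.+1) f i) \Po (\poly_(i < n.+1) g i))`_n.

Definition series_id : nat -> B := fun n => (n == 1%N)%:R.

(* f = \sum_i a_i x^(p^i) with a_0 = 1 *)
Definition p_series (f : nat -> B) : Prop :=
  f 1%N = 1 /\ forall n, f n != 0 -> exists i, n = (p ^ i)%N.

Hypothesis pB : p \in [pchar B].

Let p_pr : prime p. Proof. exact: pcharf_prime pB. Qed.

Lemma p_series_eq0 f n : p_series f -> (forall i, n <> (p ^ i)%N) -> f n = 0.
Proof.
by case=> _ fs nP; apply/eqP/negPn/negP => /fs [i]; apply: nP.
Qed.

Lemma p_seriesP f g : p_series f -> p_series g ->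
  (forall i, f (p ^ i)%N = g (p ^ i)%N) -> f = g.
Proof.
move=> fP gP fg; apply/funext => n.
have [[i ->]|nP] := pselect (exists i, n = (p ^ i)%N); first exact: fg.
by rewrite !p_series_eq0 // => i ni; apply: nP; exists i.
Qed.

Lemma series_idP : p_series series_id.
Proof.
split=> // n; rewrite /series_id.
by case: (eqVneq n 1%N) => [-> _|_]; [exists 0%N | rewrite eqxx].
Qed.

Lemma poly_expp (C : comNzRingType) (pC : p \in [pchar C]) (I : Type)
    (r : seq I) (F : I -> C) i :
  (\sum_(j <- r) F j) ^+ (p ^ i) = \sum_(j <- r) F j ^+ (p ^ i).
Proof.
elim: i => [|i IH]; first by rewrite !expn0 expr1; apply: eq_bigr.
have FrE x : x ^+ (p ^ i.+1) = pFrobenius_aut pC (x ^+ (p ^ i)).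
  by rewrite pFrobenius_autE -exprM -expnSr.
by rewrite FrE IH rmorph_sum; apply: eq_bigr => j _; rewrite FrE.
Qed.

Lemma pchar_poly : p \in [pchar {poly B}].
Proof. exact: (rmorph_pchar (polyC : {rmorphism B -> {poly B}})). Qed.

Lemma series_compE f g n : p_series f ->
  series_comp f g n =
  \sum_(k < n.+1) \sum_(l < n.+1) (f k * g l ^+ k) *+ (k * l == n)%N.
Proof.
move=> fP; rewrite /series_comp comp_polyE coef_sum.
set N := size _; set P := \poly_(i < _) g i.
transitivity (\sum_(k < n.+1) f k * (P ^+ k)`_n).
  have leN : (N <= n.+1)%N by apply: size_poly.
  rewrite (big_ord_widen _ (fun k => (_`_k *: P ^+ k)`_n) leN) big_mkcond /=.
  apply: eq_bigr => k _; case: ltnP => [_|Nk].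
    by rewrite coefZ coef_poly ltn_ord.
  have := coef_poly n.+1 f k; rewrite (nth_default _ Nk) ltn_ord => <-.
  by rewrite mul0r.
apply: eq_bigr => k _.
have [[i ki]|kP] := pselect (exists i, (k : nat) = (p ^ i)%N); last first.
  rewrite p_series_eq0 // ?mul0r; last by move=> i ki; apply: kP; exists i.
  by rewrite big1 // => l _; rewrite mul0r mul0rn.
have -> : P ^+ k = \sum_(l < n.+1) (g l *: 'X^l) ^+ k.
  by rewrite ki /P poly_def (poly_expp pchar_poly).
rewrite coef_sum big_distrr /=; apply: eq_bigr => l _.
rewrite exprZn -exprM coefZ coefXn eq_sym mulnC mulrA.
by case: eqP; rewrite ?mulr1 ?mulr0.
Qed.

Lemma series_comp_pow f g n : p_series f -> p_series g ->
  series_comp f g (p ^ n)%N =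
  \sum_(i < n.+1) \sum_(j < n.+1)
    (f (p ^ i)%N * g (p ^ j)%N ^+ (p ^ i)) *+ (i + j == n)%N.
Proof.
move=> fP gP; rewrite series_compE //.
have p1 := prime_gt1 p_pr.
have powE (F : nat -> B) : (forall k, (forall i, k <> (p ^ i)%N) -> F k = 0) ->
    \sum_(k < (p ^ n).+1) F k = \sum_(i < n.+1) F (p ^ i)%N.
  move=> F0.
  have lt (i : 'I_n.+1) : (p ^ i < (p ^ n).+1)%N.
    by rewrite ltnS leq_exp2l // -ltnS ltn_ord.
  pose h (i : 'I_n.+1) := Ordinal (lt i).
  rewrite (bigID [pred k | k \in codom h]) /= [X in _ + X]big1 ?addr0.
    have hU : uniq (codom h).
      rewrite map_inj_uniq ?enum_uniq // => i j /(congr1 val) /= /eqP.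
      by rewrite eqn_exp2l // => /eqP/val_inj.
    by rewrite -(big_uniq _ hU) /= big_image.
  move=> k kP; apply: F0 => i ki; case/negP: kP.
  have iN : (i < n.+1)%N by rewrite ltnS -(leq_exp2l _ _ p1) -ki -ltnS.
  by apply/codomP; exists (Ordinal iN); apply: val_inj.
rewrite (powE (fun k => \sum_(l < _) (f k * g l ^+ k) *+ (k * l == _)%N)).
  apply: eq_bigr => i _.
  rewrite (powE (fun l => (_ * g l ^+ _) *+ (_ * l == _)%N)).
    by apply: eq_bigr => j _; rewrite -expnD eqn_exp2l.
  move=> l lP; rewrite [g l]p_series_eq0 // expr0n.
  by rewrite expn_eq0 (gtn_eqF (prime_gt0 p_pr)) /= mulr0 mul0rn.
move=> k kP; rewrite big1 // => l _.
by rewrite [f k]p_series_eq0 // mul0r mul0rn.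
Qed.

Lemma series_compP f g : p_series f -> p_series g -> p_series (series_comp f g).
Proof.
move=> fP gP; split.
  rewrite -[1%N](expn0 p) series_comp_pow // !big_ord1 /= expn0.
  by rewrite fP.1 gP.1 expr1n mulr1.
move=> n; rewrite series_compE //; apply: contraNP => nP; apply/eqP.
rewrite big1 // => k _; rewrite big1 // => l _.
case: eqP => [klE|_]; last by rewrite mulr0n.
have [[i ki]|kP] := pselect (exists i, (k : nat) = (p ^ i)%N); last first.
  by rewrite [f k]p_series_eq0 ?mul0r ?mul0rn // => i ki; apply: kP; exists i.
rewrite [g l]p_series_eq0 // => [|j lj].
  by rewrite ki expr0n expn_eq0 (gtn_eqF (prime_gt0 p_pr)) /= mulr0 mul0rn.
by apply: nP; exists (i + j)%N; rewrite expnD -ki -lj.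
Qed.

Lemma series_comp1f f : p_series f -> series_comp series_id f = f.
Proof.
move=> fP; apply: (p_seriesP (series_compP series_idP fP) fP) => n.
rewrite (series_comp_pow _ series_idP fP) big_ord_recl [X in _ + X]big1 => [|i _].
  rewrite addr0 (bigD1 ord_max) //= big1 => [|j jn].
    by rewrite addr0 add0n eqxx expn0 expr1 mul1r.
  by rewrite add0n -[n]/(val (@ord_max n)) val_eqE (negPf jn).
rewrite big1 // => j _; rewrite /series_id -[1%N](expn0 p).
by rewrite eqn_exp2l ?prime_gt1 // mul0r mul0rn.
Qed.

(* Composition in terms of the a_n and b_n: the coefficient of x^(p^n). *)
Definition pconv (a b : nat -> B) (N n : nat) := \sum_(i < N) \sum_(j < N)
  (a i * b j ^+ (p ^ i)) *+ (i + j == n)%N.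

Lemma pconvE a b (N n : nat) : pconv a b N n =
  \sum_(i < N) \sum_(j < N) (a i * b j ^+ (p ^ i)) *+ (i + j == n)%N.
Proof. by []. Qed.

Lemma pconv_widen a b (N n : nat) : (n < N)%N -> pconv a b n.+1 n = pconv a b N n.
Proof.
move=> nN; rewrite /pconv.
rewrite (big_ord_widen _ (fun i => \sum_(j < n.+1)
  (a i * b j ^+ (p ^ i)) *+ (i + j == n)%N) nN) big_mkcond /=.
apply: eq_bigr => i _; case: ltnP => [_|ni].
  rewrite (big_ord_widen _ (fun j =>
    (a i * b j ^+ (p ^ i)) *+ (i + j == n)%N) nN) big_mkcond /=.
  apply: eq_bigr => j _; case: ltnP => // nj.
  by rewrite gtn_eqF // (leq_trans nj) ?leq_addl.
rewrite big1 // => j _.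
by rewrite gtn_eqF // (leq_trans ni) ?leq_addr.
Qed.

Lemma sum_delta (X : nat -> B) (t k n : nat) :
  \sum_(s < n.+1) X s *+ (t == s)%N *+ (s + k == n)%N = X t *+ (t + k == n)%N.
Proof.
case: (ltnP t n.+1) => [tn|nt].
  rewrite (bigD1 (Ordinal tn)) //= eqxx big1 ?addr0 // => s /negPf st.
  by rewrite [t == s]eq_sym -[t]/(val (Ordinal tn)) val_eqE st mul0rn.
rewrite big1 => [|s _].
  by rewrite gtn_eqF // (leq_trans nt) ?leq_addr.
by rewrite [t == s]gtn_eqF ?mul0rn // (leq_trans (ltn_ord s)).
Qed.

Lemma mulrb_exp (x : B) (b : bool) i : (x *+ b) ^+ (p ^ i) = x ^+ (p ^ i) *+ b.
Proof.
by case: b => //; rewrite !mulr0n expr0n expn_eq0 (gtn_eqF (prime_gt0 p_pr)).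
Qed.

Lemma pconv3 a b c (n : nat) : pconv (fun s => pconv a b s.+1 s) c n.+1 n =
  pconv a (fun s => pconv b c s.+1 s) n.+1 n.
Proof.
transitivity (\sum_(i < n.+1) \sum_(j < n.+1) \sum_(k < n.+1)
   (a i * b j ^+ (p ^ i) * c k ^+ (p ^ (i + j))) *+ (i + j + k == n)%N).
  rewrite pconvE exchange_big /=.
  under eq_bigr => k _.
    under eq_bigr => s _.
      rewrite (pconv_widen _ _ (ltn_ord s)) pconvE mulr_suml -sumrMnl.
      under eq_bigr => i _.
        rewrite mulr_suml -sumrMnl.
        over.
      over.
    rewrite exchange_big /=.
    under eq_bigr => i _.
      rewrite exchange_big /=.
      under eq_bigr => j _.
        under eq_bigr do rewrite mulrnAl.
        rewrite (sum_delta (fun s => a i * b j ^+ (p ^ i) * c k ^+ (p ^ s))).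
        over.
      over.
    over.
  rewrite exchange_big; apply: eq_bigr => i _.
  by rewrite exchange_big.
rewrite pconvE; apply: eq_bigr => i _.
under [RHS]eq_bigr => s _.
  rewrite (pconv_widen _ _ (ltn_ord s)) pconvE (poly_expp pB) mulr_sumr -sumrMnl.
  under eq_bigr => j _.
    rewrite (poly_expp pB) mulr_sumr -sumrMnl.
    under eq_bigr => k _.
      rewrite mulrb_exp exprMn -exprM -expnD mulrnAr mulrA [(i + s)%N]addnC.
      over.
    over.
  over.
rewrite [RHS]exchange_big; apply: eq_bigr => j _ /=.
rewrite [RHS]exchange_big; apply: eq_bigr => k _ /=.
rewrite (sum_delta (fun s => a i * b j ^+ (p ^ i) * c k ^+ (p ^ (j + i)))).
by rewrite [(j + i)%N]addnC -addnA [(j + k + i)%N]addnC.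
Qed.

Lemma series_compA f g h : p_series f -> p_series g -> p_series h ->
  series_comp f (series_comp g h) = series_comp (series_comp f g) h.
Proof.
move=> fP gP hP; have fgP := series_compP fP gP.
have ghP := series_compP gP hP.
apply: p_seriesP => [||n]; try exact: series_compP.
pose u (F : nat -> B) i := F (p ^ i)%N.
have compE F G : p_series F -> p_series G -> forall m,
    series_comp F G (p ^ m)%N = pconv (u F) (u G) m.+1 m.
  by move=> FP GP m; rewrite series_comp_pow.
rewrite !compE //.
have -> : u (series_comp g h) = fun s => pconv (u g) (u h) s.+1 s.
  by apply/funext => s; rewrite /u compE.
have -> : u (series_comp f g) = fun s => pconv (u f) (u g) s.+1 s.
  by apply/funext => s; rewrite /u compE.
by rewrite pconv3.
Qed.

(* Coefficients of the left inverse, by recursion on the exponent. *)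
Fixpoint inv_coefs (f : nat -> B) n : seq B :=
  if n is m.+1 then
    let s := inv_coefs f m in
    rcons s (- \sum_(i < m.+1) s`_i * f (p ^ (m.+1 - i))%N ^+ (p ^ i))
  else [:: 1].

Definition series_inv (f : nat -> B) : nat -> B := fun n =>
  let i := logn p n in if n == (p ^ i)%N then (inv_coefs f i)`_i else 0.

Lemma series_inv_pow f i : series_inv f (p ^ i)%N = (inv_coefs f i)`_i.
Proof. by rewrite /series_inv pfactorK // eqxx. Qed.

Lemma series_invP f : p_series (series_inv f).
Proof.
split=> [|n]; first by rewrite -[1%N](expn0 p) series_inv_pow.
rewrite /series_inv; case: (eqVneq n (p ^ logn p n)%N) => [nE _|_].
  by exists (logn p n).
by rewrite eqxx.
Qed.

Lemma size_inv_coefs f n : size (inv_coefs f n) = n.+1.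
Proof. by elim: n => //= n IH; rewrite size_rcons IH. Qed.

Lemma nth_inv_coefs f n i : (i <= n)%N ->
  (inv_coefs f n)`_i = (inv_coefs f i)`_i.
Proof.
elim: n => [|n IH]; first by rewrite leqn0 => /eqP ->.
rewrite leq_eqVlt => /predU1P[-> //|lt_in].
by rewrite /= nth_rcons size_inv_coefs lt_in IH.
Qed.

Lemma series_compVf f : p_series f ->
  series_comp (series_inv f) f = series_id.
Proof.
move=> fP; apply: (p_seriesP (series_compP (series_invP f) fP) series_idP) => n.
rewrite (series_comp_pow _ (series_invP f) fP).
under eq_bigr => i _.
  have lt : (n - i < n.+1)%N by rewrite ltnS leq_subr.
  rewrite (bigD1 (Ordinal lt)) //= subnKC -1?ltnS // eqxx big1 => [|j jn].
    rewrite addr0 mulr1n series_inv_pow.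
    over.
  case: eqP => // ijn; case/eqP: jn; apply: val_inj => /=.
  by rewrite -(addKn i j) ijn.
rewrite big_ord_recr /= subnn expn0 fP.1 expr1n mulr1.
case: n => [|n]; first by rewrite big_ord0 add0r /= expn0.
rewrite /= nth_rcons size_inv_coefs ltnn eqxx.
rewrite /series_id -[1%N in RHS](expn0 p) eqn_exp2l ?prime_gt1 //=.
under eq_bigr => i _ do rewrite -(@nth_inv_coefs f n i (ltn_ord i)).
by rewrite subrr.
Qed.

Definition Pgroup of p \in [pchar B] : Type := {f : nat -> B | p_series f}.

Local Notation G := (Pgroup pB).

HB.instance Definition _ := gen_eqMixin G.
HB.instance Definition _ := gen_choiceMixin G.

Definition Pgroup_one : G := exist _ series_id series_idP.
Definition Pgroup_mul (f g : G) : G :=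
  exist _ (series_comp (sval f) (sval g)) (series_compP (svalP f) (svalP g)).
Definition Pgroup_inv (f : G) : G :=
  exist _ (series_inv (sval f)) (series_invP (sval f)).

Lemma Pgroup_ext (f g : G) : sval f = sval g -> f = g.
Proof.
case: f g => [f fP] [g gP] /= fg; case: _ / fg gP => gP.
by congr exist; apply: Prop_irrelevance.
Qed.

Lemma Pgroup_mulA : associative Pgroup_mul.
Proof.
move=> [f fP] [g gP] [h hP]; apply: Pgroup_ext.
exact: series_compA.
Qed.

Lemma Pgroup_mul1g : left_id Pgroup_one Pgroup_mul.
Proof. by move=> [f fP]; apply: Pgroup_ext; apply: series_comp1f. Qed.

Lemma Pgroup_mulVg : left_inverse Pgroup_one Pgroup_inv Pgroup_mul.
Proof. by move=> [f fP]; apply: Pgroup_ext; apply: series_compVf. Qed.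

Lemma Pgroup_mulgV : right_inverse Pgroup_one Pgroup_inv Pgroup_mul.
Proof.
move=> f; rewrite -[LHS]Pgroup_mul1g -{1}(Pgroup_mulVg (Pgroup_inv f)).
by rewrite -Pgroup_mulA [Pgroup_mul (_ f) _]Pgroup_mulA Pgroup_mulVg
  Pgroup_mul1g Pgroup_mulVg.
Qed.

Lemma Pgroup_mulg1 : right_id Pgroup_one Pgroup_mul.
Proof.
by move=> f; rewrite -(Pgroup_mulVg f) Pgroup_mulA Pgroup_mulgV Pgroup_mul1g.
Qed.

HB.instance Definition _ := isGroup.Build G
  Pgroup_mulA Pgroup_mul1g Pgroup_mulg1 Pgroup_mulVg Pgroup_mulgV.

End PSeries.

(* {malg k[K]} is the free k-module on K; this is linear extension from the   *)
(* basis K.                                                                   *)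
Section LinearExtension.
Variables (k : nzRingType) (V : lmodType k) (K : choiceType) (h : K -> V).

Definition mlin (a : {malg k[K]}) : V := \sum_(x <- msupp a) a@_x *: h x.

Lemma mlinEw (d : {fset K}) a : (msupp a `<=` d)%fset ->
  mlin a = \sum_(x <- d) a@_x *: h x.
Proof.
move=> le; rewrite /mlin [RHS](big_fsetID _ (mem (msupp a))) /=.
rewrite [X in _ = _ + X]big1_fset ?addr0 => [|x]; last first.
  by rewrite !inE /= => /andP[_ xa] _; rewrite mcoeff_outdom ?scale0r.
apply: eq_fbigl => x; rewrite !inE /=.
by case: (boolP (x \in msupp a)) => [/(fsubsetP le) ->|_]; rewrite ?andbF.
Qed.

Lemma mlin_is_linear : linear mlin.
Proof.
move=> c a b.
rewrite (@mlinEw (msupp a `|` msupp b)%fset); last first.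
  by apply: fsubset_trans (msuppD_le _ _) _; rewrite fsetSU // msuppZ_le.
rewrite (mlinEw (fsubsetUl _ (msupp b))) (mlinEw (fsubsetUr (msupp a) _)).
rewrite scaler_sumr -big_split /=; apply: eq_bigr => x _.
by rewrite mcoeffD mcoeffZ scalerDl scalerA.
Qed.

HB.instance Definition _ :=
  GRing.isLinear.Build k {malg k[K]} V *:%R mlin mlin_is_linear.

Lemma mlinU x : mlin << x >> = h x.
Proof.
by rewrite (@mlinEw [fset x]%fset) ?msuppU_le // big_seq_fset1 mcoeffUU scale1r.
Qed.

End LinearExtension.

(* The tensor product of the free modules on K and L is the free module on    *)
(* K * L; the product of monoids makes it the tensor product of the monoid    *)
(* algebras.                                                                  *)
Section Tensor.
Variables (k : nzRingType) (K L : choiceType).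

Definition tens (a : {malg k[K]}) (b : {malg k[L]}) : {malg k[(K * L)%type]} :=
  mlin (fun x => mlin (fun y => << (x, y) >>) b) a.

End Tensor.

Section ProductMonoid.
Variables M N : monomType.

Definition prod_mone : M * N := (mone, mone).
Definition prod_mmul (x y : M * N) : M * N := (mmul x.1 y.1, mmul x.2 y.2).

Lemma prod_mmulA : associative prod_mmul.
Proof. by move=> x y z; rewrite /prod_mmul !mulmA. Qed.
Lemma prod_mul1m : left_id prod_mone prod_mmul.
Proof. by case=> x y; rewrite /prod_mmul !mul1m. Qed.
Lemma prod_mulm1 : right_id prod_mone prod_mmul.
Proof. by case=> x y; rewrite /prod_mmul !mulm1. Qed.
Lemma prod_unitm x y : prod_mmul x y = prod_mone ->
  x = prod_mone /\ y = prod_mone.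
Proof. by case: x y => [a b] [c d] [/unitm[-> ->] /unitm[-> ->]]. Qed.

HB.instance Definition _ := Choice_isMonomialDef.Build (M * N)%type
  prod_mmulA prod_mul1m prod_mulm1 prod_unitm.

End ProductMonoid.

Section ProductConomoid.
Variables M N : conomType.

Lemma prod_mmulC : commutative (@prod_mmul M N).
Proof. by move=> x y; rewrite /prod_mmul mulmC [mmul x.2 _]mulmC. Qed.

HB.instance Definition _ :=
  MonomialDef_isConomialDef.Build (M * N)%type prod_mmulC.

End ProductConomoid.

(* Hom_k(U, A) for U the free k-module on K, and its topology *)
Section Dual.
Variables (k : comNzRingType) (A : comAlgType k) (K : choiceType).

Record dual : Type := Dual {
  dual_fun :> {malg k[K]} -> A;
  dual_linear : linear dual_fun
}.

HB.instance Definition _ (f : dual) :=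
  GRing.isLinear.Build k {malg k[K]} A *:%R (dual_fun f) (dual_linear f).

HB.instance Definition _ := gen_eqMixin dual.
HB.instance Definition _ := gen_choiceMixin dual.

Lemma dualP (f g : dual) : (forall u, f u = g u) -> f = g.
Proof.
case: f g => [f fP] [g gP] /= /funext fg; case: _ / fg gP => gP.
by congr Dual; apply: Prop_irrelevance.
Qed.

Lemma dual_zero_subproof : linear (fun _ : {malg k[K]} => 0 : A).
Proof. by move=> c u v; rewrite scaler0 addr0. Qed.
Lemma dual_opp_subproof (f : dual) : linear (fun u => - f u).
Proof. by move=> c u v; rewrite linearP opprD scalerN. Qed.
Lemma dual_add_subproof (f g : dual) : linear (fun u => f u + g u).
Proof. by move=> c u v; rewrite !linearP scalerDr addrACA. Qed.
Lemma dual_scale_subproof (a : A) (f : dual) : linear (fun u => a * f u).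
Proof. by move=> c u v; rewrite linearP mulrDr scalerAr. Qed.

Definition dual_zero := Dual dual_zero_subproof.
Definition dual_opp f := Dual (dual_opp_subproof f).
Definition dual_add f g := Dual (dual_add_subproof f g).
Definition dual_scale a f := Dual (dual_scale_subproof a f).

Lemma dual_addA : associative dual_add.
Proof. by move=> f g h; apply: dualP => u /=; rewrite addrA. Qed.
Lemma dual_addC : commutative dual_add.
Proof. by move=> f g; apply: dualP => u /=; rewrite addrC. Qed.
Lemma dual_add0 : left_id dual_zero dual_add.
Proof. by move=> f; apply: dualP => u /=; rewrite add0r. Qed.
Lemma dual_addN : left_inverse dual_zero dual_opp dual_add.
Proof. by move=> f; apply: dualP => u /=; rewrite addNr. Qed.

HB.instance Definition _ :=
  GRing.isZmodule.Build dual dual_addA dual_addC dual_add0 dual_addN.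

Lemma dual_scaleA a b f : dual_scale a (dual_scale b f) = dual_scale (a * b) f.
Proof. by apply: dualP => u /=; rewrite mulrA. Qed.
Lemma dual_scale1 : left_id 1 dual_scale.
Proof. by move=> f; apply: dualP => u /=; rewrite mul1r. Qed.
Lemma dual_scaleDr : right_distributive dual_scale +%R.
Proof. by move=> a f g; apply: dualP => u /=; rewrite mulrDr. Qed.
Lemma dual_scaleDl f : {morph dual_scale^~ f : a b / a + b}.
Proof. by move=> a b; apply: dualP => u /=; rewrite mulrDl. Qed.

HB.instance Definition _ := GRing.Zmodule_isLmodule.Build A dual
  dual_scaleA dual_scale1 dual_scaleDr dual_scaleDl.

(* The A-linear form on U (x) A = {malg A[K]} extending f *)
Definition dual_ext (f : dual) : {malg A[K]} -> A :=
  mlin (fun x => f << x >> : A^o).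

Definition annihilator (W : set {malg A[K]}) : set dual :=
  [set f | forall w, W w -> dual_ext f w = 0].

Definition free_finite_rank (W : set {malg A[K]}) : Prop :=
  exists n (e : 'I_n -> {malg A[K]}),
    (forall c : 'I_n -> A, \sum_i c i *: e i = 0 -> forall i, c i = 0) /\
    W = [set w | exists c : 'I_n -> A, w = \sum_i c i *: e i].

Definition dual_nbhs (f : dual) : set_system dual :=
  [set U | exists W, free_finite_rank W /\
                     [set f + h | h in annihilator W] `<=` U].

Lemma dual_extD f g w : dual_ext (f + g) w = dual_ext f w + dual_ext g w.
Proof.
rewrite /dual_ext /mlin -big_split /=; apply: eq_bigr => x _; apply: mulrDr.
Qed.

Lemma annihilator0 W : annihilator W 0.
Proof. by move=> w _; rewrite /dual_ext /mlin big1 // => x _; rewrite scaler0. Qed.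

Lemma annihilatorD W f g :
  annihilator W f -> annihilator W g -> annihilator W (f + g).
Proof. by move=> fW gW w Ww; rewrite dual_extD fW // gW // addr0. Qed.

Lemma free_finite_rank_supp (d : {fset K}) :
  free_finite_rank [set w : {malg A[K]} | (msupp w `<=` d)%fset].
Proof.
pose t := in_tuple (enum_fset d).
have t_inj : injective (tnth t) by apply/tuple_uniqP; exact: fset_uniq.
have coefE (c : 'I_(size (enum_fset d)) -> A) x :
    (\sum_i c i *: << tnth t i >>)@_x = \sum_(i | tnth t i == x) c i.
  rewrite raddf_sum [RHS]big_mkcond; apply: eq_bigr => i _ /=.
  rewrite mcoeffZ mcoeffU; case: eqP => _; rewrite ?mulr1 ?mulr0 //.
exists (size (enum_fset d)), (fun i => << tnth t i >>); split=> [c c0 i|].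
  have := coefE c (tnth t i); rewrite c0 mcoeff0 (big_pred1 i) // => j.
  by rewrite (inj_eq t_inj).
apply/seteqP; split=> w /=.
  move=> wd; exists (fun i => w@_(tnth t i)); apply/malgP => x.
  rewrite coefE; case: (msuppP w x) => [xw|xw].
    have /tnthP [i xi] : x \in t by apply: (fsubsetP wd).
    by rewrite (big_pred1 i) -?xi // => j; rewrite xi (inj_eq t_inj).
  by rewrite big1 // => i /eqP ->; rewrite mcoeff_outdom.
move=> [c ->]; apply/fsubsetP => x; rewrite -mcoeff_neq0 coefE.
apply: contraNT => xd; rewrite big_pred0 // => i.
by apply: contraNF xd => /eqP <-; exact: mem_tnth.
Qed.

Lemma free_finite_rank_sub (W : set {malg A[K]}) : free_finite_rank W ->
  exists d : {fset K}, W `<=` [set w | (msupp w `<=` d)%fset].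
Proof.
move=> [n [e [_ ->]]].
exists (\big[@fsetU K/fset0]_(i < n) msupp (e i)) => _ [c ->] /=.
apply/fsubsetP => x; rewrite -mcoeff_neq0; apply: contraNT => xd.
apply/eqP; rewrite raddf_sum big1 // => i _ /=.
rewrite mcoeffZ mcoeff_outdom ?mulr0 //.
by apply: contra xd => xi; rewrite (bigD1 i) //= inE xi.
Qed.

Lemma dual_nbhs_singleton f U : dual_nbhs f U -> U f.
Proof.
move=> [W [_ WU]]; apply: WU; exists 0; last by rewrite addr0.
exact: annihilator0.
Qed.

Lemma dual_nbhs_filter f : ProperFilter (dual_nbhs f).
Proof.
split=> [/dual_nbhs_singleton//|]; split.
- exists [set w | (msupp w `<=` fset0)%fset].
  by split=> //; exact: free_finite_rank_supp.
- move=> U V [W1 [/free_finite_rank_sub [d1 s1] W1U]].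
  move=> [W2 [/free_finite_rank_sub [d2 s2] W2V]].
  exists [set w | (msupp w `<=` d1 `|` d2)%fset].
  split; first exact: free_finite_rank_supp.
  move=> _ [h hW <-]; split.
    apply: W1U; exists h => // w /s1 /= wd; apply: hW => /=.
    exact: fsubset_trans wd (fsubsetUl _ _).
  apply: W2V; exists h => // w /s2 /= wd; apply: hW => /=.
  exact: fsubset_trans wd (fsubsetUr _ _).
- move=> U V UV [W [fW WU]]; exists W; split=> //.
  exact: subset_trans WU UV.
Qed.

Lemma dual_nbhs_nbhs f U : dual_nbhs f U -> dual_nbhs f (dual_nbhs^~ U).
Proof.
move=> [W [fW WU]]; exists W; split=> // _ [h hW <-].
exists W; split=> // _ [h' h'W <-]; apply: WU; exists (h + h').
  exact: annihilatorD.
by rewrite addrA.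
Qed.

HB.instance Definition _ := hasNbhs.Build dual dual_nbhs.
HB.instance Definition _ := Nbhs_isNbhsTopological.Build dual
  dual_nbhs_filter dual_nbhs_singleton dual_nbhs_nbhs.

End Dual.

Section DualMaps.
Variables (k : comNzRingType) (A : comAlgType k) (K L : choiceType).

Lemma dual_pull_subproof (u : {linear {malg k[K]} -> {malg k[L]}})
  (f : dual A L) : linear (fun a => f (u a)).
Proof. by move=> c a b; rewrite !linearP. Qed.

Definition dual_pull u f : dual A K := Dual (dual_pull_subproof u f).

(* f (x) g followed by the multiplication of A *)
Definition dual_tens (f : dual A K) (g : dual A L) : dual A (K * L)%type :=
  Dual (mlin_is_linear (fun xy => f << xy.1 >> * g << xy.2 >>)).

End DualMaps.

(* The library makes {malg A[G]} a ring only for monoids without nontrivial   *)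
(* invertible elements, hence the explicit product.                           *)
Section GroupAlgebra.
Variables (A : comNzRingType) (G : groupType).
Implicit Types a b : {malg A[G]}.

Definition galg_one : {malg A[G]} := << 1%g >>.
Definition galg_mul a b : {malg A[G]} :=
  mlin (fun g => mlin (fun h => << (g * h)%g >>) b) a.
Definition galg_counit a : A := mlin (fun _ : G => 1 : A^o) a.
Definition galg_coprod a : {malg A[(G * G)%type]} :=
  mlin (fun g => << (g, g) >>) a.
Definition galg_antipode a : {malg A[G]} := mlin (fun g => << (g^-1)%g >>) a.

End GroupAlgebra.

Section PHopf.
Variable p : nat.

(* P = F_p[x_1, x_2, ...]; the variable i of {cmonom nat} stands for x_(i+1). *)
Local Notation mon := {cmonom nat}.
Local Notation P := {malg 'F_p[mon]}.
Local Notation PP := {malg 'F_p[(mon * mon)%type]}.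

(* x_n, with the convention x_0 = 1 *)
Definition xvar (n : nat) : P := if n is i.+1 then << ucm i >> else 1.

(* The algebra morphism sending x_n to v n, for n > 0 *)
Definition P_lift (S : comAlgType 'F_p) (v : nat -> S) : P -> S :=
  mlin (fun m : mon => \prod_(i <- finsupp m) v i.+1 ^+ m i).

HB.instance Definition _ (S : comAlgType 'F_p) (v : nat -> S) :=
  GRing.Linear.on (P_lift v).

Definition P_counit : P -> 'F_p := mcoeff mone.

Definition P_mul : PP -> P := mlin (fun xy : mon * mon => << mmul xy.1 xy.2 >>).
HB.instance Definition _ := GRing.Linear.on P_mul.

Definition P_coprod : P -> PP :=
  P_lift (fun n => tens (xvar n) 1 + tens 1 (xvar n) +
    \sum_(1 <= k < n) tens (xvar k) (xvar (n - k) ^+ (p ^ k))).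
HB.instance Definition _ := GRing.Linear.on P_coprod.

Hypothesis p_pr : prime p.

Lemma pchar_P : p \in [pchar P].
Proof. exact: (rmorph_pchar (@malgC mon 'F_p) (pchar_Fp p_pr)). Qed.

(* The generic series x + x_1 x^p + x_2 x^(p^2) + ..., which corresponds to   *)
(* the identity of P under the representability of B |-> P(B); the antipode   *)
(* corresponds to its inverse for composition.                                *)
Definition generic_series : nat -> P := fun n =>
  let i := logn p n in if n == (p ^ i)%N then xvar i else 0.

Lemma generic_seriesP : p_series p generic_series.
Proof.
split=> [|n]; first by rewrite /generic_series logn1 expn0 eqxx.
rewrite /generic_series; case: (eqVneq n (p ^ logn p n)%N) => [nE _|_].
  by exists (logn p n).
by rewrite eqxx.
Qed.

Definition generic_elt : Pgroup pchar_P := exist _ generic_series generic_seriesP.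

Definition P_antipode : P -> P :=
  P_lift (fun n => sval (generic_elt^-1)%g (p ^ n)%N).
HB.instance Definition _ := GRing.Linear.on P_antipode.

End PHopf.

(* The structure of topological Hopf algebra of Hom_(F_p)(P, A) *)
Section DualHopf.
Variables (p : nat) (A : comAlgType 'F_p).

Local Notation mon := {cmonom nat}.
Local Notation D := (dual A mon).

Lemma dual_one_subproof :
  linear (fun a : {malg 'F_p[mon]} => (P_counit a)%:A : A).
Proof.
by move=> c a b; rewrite /P_counit mcoeffD mcoeffZ scalerDl scalerA.
Qed.

Definition dual_one : D := Dual dual_one_subproof.
Definition dual_mul (f g : D) : D := dual_pull (@P_coprod p) (dual_tens f g).
Definition dual_counit (f : D) : A := f 1.
Definition dual_coprod (f : D) : dual A (mon * mon)%type :=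
  dual_pull (@P_mul p) f.
Definition dual_antipode (p_pr : prime p) (f : D) : D :=
  dual_pull (P_antipode p_pr) f.

(* In the condition on coproducts, the image of \Delta(a) under Phi (x) Phi   *)
(* is taken in Hom(P (x) P, A), the completed tensor square of Hom(P, A).     *)
Record hopf_morphism (p_pr : prime p) (G : groupType)
    (Phi : {malg A[G]} -> D) : Prop := HopfMorphism {
  hopf_one : Phi (galg_one A G) = dual_one;
  hopf_mul : forall a b, Phi (galg_mul a b) = dual_mul (Phi a) (Phi b);
  hopf_counit : forall a, dual_counit (Phi a) = galg_counit a;
  hopf_coprod : forall a, dual_coprod (Phi a) =
    mlin (fun gh : G * G => dual_tens (Phi << gh.1 >>) (Phi << gh.2 >>))
         (galg_coprod a);
  hopf_antipode : forall a,
    Phi (galg_antipode a) = dual_antipode p_pr (Phi a)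
}.

End DualHopf.

(* Main.v *)
From HB Require Import structures.
Require Import Defs.
From mathcomp Require Import all_boot all_algebra all_field finmap.
From mathcomp Require Import all_classical.
From mathcomp Require Import topology_structure.
From mathcomp Require Import monalg.

Set Implicit Arguments.
Unset Strict Implicit.
Unset Printing Implicit Defensive.

Import GRing.Theory.
Local Open Scope classical_set_scope.
Local Open Scope ring_scope.

(** The group P(Q) is the group of Q-points of P: an element with coefficients
    a_n is the algebra morphism x_n |-> a_n. Such a morphism, followed by the
    inclusion of Q in R, is a linear map from P to R, and the map from R[P(Q)]
    to Hom(P, R) is the R-linear extension of this assignment.

    Compatibility with the Hopf structures is R-multilinear, so it need only be
    checked on group elements, where it says that composing two series is the
    convolution of the corresponding points ([Pchar_mul]), that the identity
    and the inverse correspond to the counit and the antipode ([Pchar_one],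
    [Pchar_inv]), and that points are grouplike because they are
    multiplicative. An identity between algebra morphisms on P reduces to the
    generators x_n, by [P_lift_comp] and [eq_P_lift].

    Injectivity is Dedekind's theorem ([sum_characters_eq0]): distinct
    multiplicative maps from the monoid of monomials to the domain R are
    linearly independent over R, and distinct elements of P(Q) give distinct
    maps.

    Density is where the DS hypothesis enters. A neighbourhood only sees the
    values of a functional on a finite set of monomials, so it suffices to
    produce, for each monomial in such a set, a combination of points taking the
    value 1 there and 0 on the others ([galg_dual_delta]). Such monomials
    involve n variables with exponents less than some k. Letting the first n
    coefficients of the series range over the k points q_0, ..., q_(k-1), the
    values of the monomials form an n-fold tensor power of a Vandermonde matrix;
    its determinant is a product of differences q_j - q_i, so it is invertible
    over R itself, not just over the fraction field ([monomial_functionals]). *)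

Local Notation mon := {cmonom nat}.

(** * Linear extension from a basis *)

Section LinearExtensionTheory.
Variables (k : nzRingType) (K : choiceType).

Lemma malg_scaleU (c : k) (x : K) : << c *g x >> = c *: << x >>.
Proof. by apply/malgP => y; rewrite mcoeffZ !mcoeffU mulrnAr mulr1. Qed.

Lemma linear_malg_ext (V : lmodType k) (f g : {malg k[K]} -> V) :
  linear f -> linear g -> (forall x, f << x >> = g << x >>) -> f =1 g.
Proof.
move=> fL gL fg a.
pose F := HB.pack_for {linear {malg k[K]} -> V} f
  (GRing.isLinear.Build _ _ _ _ _ fL).
pose H := HB.pack_for {linear {malg k[K]} -> V} g
  (GRing.isLinear.Build _ _ _ _ _ gL).
rewrite -[f]/(F : _ -> _) -[g]/(H : _ -> _) (monalgE a) !linear_sum.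
by apply: eq_bigr => x _; rewrite malg_scaleU !linearZ /= fg.
Qed.

End LinearExtensionTheory.

(** The universal property of a monoid algebra. *)
Lemma mlin_monoid_morphism (k : comNzRingType) (K : conomType)
    (B : comAlgType k) (h : K -> B) :
  h mone = 1 -> {morph h : x y / mmul x y >-> x * y} ->
  monoid_morphism (mlin h).
Proof.
move=> h1 hM; split=> [|a b]; first by rewrite -[1]/(<< mone >>) mlinU.
move: a; apply: linear_malg_ext => [c a a'|c a a'|x].
- by rewrite mulrDl -scalerAl linearP.
- by rewrite linearP mulrDl -scalerAl.
rewrite mlinU; move: b; apply: linear_malg_ext => [c b b'|c b b'|y].
- by rewrite mulrDr -scalerAr linearP.
- by rewrite linearP mulrDr -scalerAr.
by rewrite malgME !msuppU oner_eq0 !big_seq_fset1 !mcoeffUU mulr1 !mlinU hM.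
Qed.

(** * Algebra morphisms out of P *)

Section PLiftTheory.
Variables (p : nat) (B : comAlgType 'F_p).
Implicit Type v : nat -> B.

(** The value at v of a monomial, the variable i standing for x_(i+1). *)
Definition mon_eval v (m : mon) : B := \prod_(i <- finsupp m) v i.+1 ^+ m i.

Lemma mon_evalw v (m : mon) (d : {fset nat}) : (finsupp m `<=` d)%fset ->
  mon_eval v m = \prod_(i <- d) v i.+1 ^+ m i.
Proof.
move=> md; apply: big_fset_incl => // i _ im.
by move: im; rewrite -cmE_eq0 => /eqP ->; rewrite expr0.
Qed.

Lemma mon_eval1 v : mon_eval v mone = 1.
Proof. by rewrite /mon_eval mdom1 big_seq_fset0. Qed.

Lemma mon_evalM v : {morph mon_eval v : x y / mmul x y >-> x * y}.
Proof.
move=> x y; rewrite {1}/mon_eval mdomD.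
rewrite (mon_evalw v (fsubsetUl (finsupp x) (finsupp y))).
rewrite (mon_evalw v (fsubsetUr (finsupp x) (finsupp y))) -big_split /=.
by apply: eq_bigr => i _; rewrite cmM exprD.
Qed.

Lemma P_liftU v m : P_lift v << m >> = mon_eval v m.
Proof. exact: mlinU. Qed.

Lemma P_lift_ucm v i : P_lift v << ucm i >> = v i.+1.
Proof. by rewrite P_liftU /mon_eval mdomU big_seq_fset1 cmUU expr1. Qed.

Lemma P_lift_monoid_morphism v : monoid_morphism (P_lift v).
Proof. exact: mlin_monoid_morphism (mon_eval1 v) (mon_evalM v). Qed.

HB.instance Definition _ v :=
  GRing.isMonoidMorphism.Build _ _ (P_lift v) (P_lift_monoid_morphism v).

Lemma P_lift_xvar v n : v 0%N = 1 -> P_lift v (xvar p n) = v n.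
Proof. by case: n => [->|n _]; [exact: rmorph1 | exact: P_lift_ucm]. Qed.

Lemma eq_P_lift v w : (forall n, v n.+1 = w n.+1) -> P_lift v =1 P_lift w.
Proof.
move=> vw; apply: linear_malg_ext; try exact: linearP.
by move=> m; rewrite !P_liftU /mon_eval; apply: eq_bigr => i _; rewrite vw.
Qed.

End PLiftTheory.

(** Algebra morphisms out of P are determined by their values on the x_n. *)
Lemma P_lift_comp (p : nat) (B C : comAlgType 'F_p) (phi : B -> C)
    (v : nat -> B) : linear phi -> monoid_morphism phi ->
  (fun a => phi (P_lift v a)) =1 P_lift (fun n => phi (v n)).
Proof.
move=> phiL phiM.
pose Phi := HB.pack_for {lrmorphism B -> C} phi
  (GRing.isLinear.Build _ _ _ _ _ phiL)
  (GRing.isMonoidMorphism.Build _ _ _ phiM).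
apply: linear_malg_ext => [c a b|c a b|m];
  rewrite -?[phi]/(Phi : _ -> _) ?linearP //.
rewrite !P_liftU /mon_eval rmorph_prod.
by apply: eq_bigr => i _; rewrite rmorphXn.
Qed.

(** * Linearity of the operations on the dual *)

Section DualSums.
Variables (k : comNzRingType) (A : comAlgType k) (K : choiceType).
Implicit Type f : dual A K.

Lemma dual_funD f a b : f (a + b) = f a + f b.
Proof. exact: linearD. Qed.

Lemma dual_fun_sum f (I : Type) (r : seq I) (F : I -> {malg k[K]}) :
  f (\sum_(i <- r) F i) = \sum_(i <- r) f (F i).
Proof. exact: linear_sum. Qed.

Lemma dual_sumE (I : Type) (r : seq I) (c : I -> A) (F : I -> dual A K) u :
  (\sum_(i <- r) c i *: F i) u = \sum_(i <- r) c i * F i u.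
Proof. exact: (big_morph (fun f => dual_fun f u)). Qed.

End DualSums.

Section DualTens.
Variables (k : comNzRingType) (A : comAlgType k) (K L : choiceType).
Implicit Types (f : dual A K) (g : dual A L).

Lemma dual_tensU f g x y : dual_tens f g << (x, y) >> = f << x >> * g << y >>.
Proof. exact: mlinU. Qed.

Lemma dual_tensE f g a b : dual_tens f g (tens a b) = f a * g b.
Proof.
rewrite /tens; move: a; apply: linear_malg_ext => [c a a'|c a a'|x].
- by rewrite !linearP.
- by rewrite linearP mulrDl -scalerAl.
rewrite mlinU; move: b; apply: linear_malg_ext => [c b b'|c b b'|y].
- by rewrite !linearP.
- by rewrite linearP mulrDr -scalerAr.
by rewrite mlinU dual_tensU.
Qed.

(** The argument has the shape of the coproduct of a generator of P. *)
Lemma dual_tens_coprodE f g a b a' b' (I : Type) (r : seq I) F F' :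
  dual_tens f g (tens a b + tens a' b' + \sum_(i <- r) tens (F i) (F' i)) =
  f a * g b + f a' * g b' + \sum_(i <- r) f (F i) * g (F' i).
Proof.
rewrite dual_funD [X in X + _]dual_funD [X in _ + X]dual_fun_sum.
congr (_ + _ + _); try exact: dual_tensE.
by apply: eq_bigr => i _; exact: dual_tensE.
Qed.

Lemma dual_tens_linearl g : linear (fun f => dual_tens f g).
Proof.
move=> c f f'; apply: dualP; apply: linear_malg_ext; try exact: linearP.
case=> x y; rewrite -[RHS]/(c * dual_tens f g _ + dual_tens f' g _) !dual_tensU.
by rewrite mulrA -mulrDl.
Qed.

Lemma dual_tens_linearr f : linear (dual_tens f : dual A L -> _).
Proof.
move=> c g g'; apply: dualP; apply: linear_malg_ext; try exact: linearP.
case=> x y; rewrite -[RHS]/(c * dual_tens f g _ + dual_tens f g' _) !dual_tensU.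
by rewrite mulrCA -mulrDr.
Qed.

End DualTens.

(** * The character of P attached to an element of P(Q) *)

(** The coefficients of the compositional inverse are universal polynomials in
    those of the series. This carries the inverse of the generic series, which
    defines the antipode of P, to the inverse of each of its specializations. *)
Lemma rmorph_inv_coefs (p : nat) (B C : comNzRingType)
    (phi : {rmorphism B -> C}) (f : nat -> B) (f' : nat -> C) :
  (forall n, f' (p ^ n)%N = phi (f (p ^ n)%N)) ->
  forall n i, (inv_coefs p f' n)`_i = phi (inv_coefs p f n)`_i.
Proof.
move=> ff' n i.
have -> : inv_coefs p f' n = map phi (inv_coefs p f n).
  elim: n => [|n IH] /=; first by rewrite rmorph1.
  rewrite map_rcons IH rmorphN rmorph_sum; congr (rcons _ (- _)).
  apply: eq_bigr => j _.
  by rewrite (nth_map 0) ?size_inv_coefs // rmorphM rmorphXn ff'.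
have [ltin|lein] := ltnP i (size (inv_coefs p f n)); first exact: nth_map.
by rewrite !nth_default ?rmorph0 ?size_map.
Qed.

Section Characters.
Variables (p : nat) (p_pr : prime p) (A : comAlgType 'F_p) (Q : comNzRingType).
Variables (pQ : p \in [pchar Q]) (iota : {rmorphism Q -> A}).
Local Notation G := (Pgroup pQ).
Implicit Types g h : G.

Definition Pgroup_coef g (n : nat) : A := iota (sval g (p ^ n)%N).

Lemma Pgroup_coef0 g : Pgroup_coef g 0 = 1.
Proof. by rewrite /Pgroup_coef expn0 (svalP g).1 rmorph1. Qed.

Lemma Pgroup_coef_one n : Pgroup_coef 1%g n.+1 = 0.
Proof.
rewrite /Pgroup_coef -[sval _]/(series_id Q) /series_id -[1%N](expn0 p).
by rewrite eqn_exp2l ?prime_gt1 // rmorph0.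
Qed.

(** This is the coproduct of x_n, with x_0 = 1, evaluated at g and h. *)
Lemma Pgroup_coefM g h n : Pgroup_coef (g * h)%g n =
  \sum_(k < n.+1) Pgroup_coef g k * Pgroup_coef h (n - k) ^+ (p ^ k).
Proof.
rewrite /Pgroup_coef -[sval _]/(series_comp (sval g) (sval h)).
rewrite (series_comp_pow pQ n (svalP g) (svalP h)) rmorph_sum.
apply: eq_bigr => k _.
have lt : (n - k < n.+1)%N by rewrite ltnS leq_subr.
rewrite (bigD1 (Ordinal lt)) //= subnKC -1?ltnS // eqxx mulr1n.
rewrite big1 ?addr0 => [|j jn]; first by rewrite rmorphM rmorphXn.
case: eqP => // kjn; case/eqP: jn; apply: val_inj => /=.
by rewrite -(addKn k j) kjn.
Qed.

Lemma Pgroup_coef_inj : injective iota ->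
  forall g h, (forall n, Pgroup_coef g n.+1 = Pgroup_coef h n.+1) -> g = h.
Proof.
move=> iota_inj g h gh; apply: Pgroup_ext.
apply: (p_seriesP (svalP g) (svalP h)) => -[|n]; last first.
  by apply: iota_inj; exact: (gh n).
by rewrite expn0 (svalP g).1 (svalP h).1.
Qed.

(** The point of P, with values in A, that corresponds to g. *)
Definition Pchar g : dual A mon := Dual (linearP (P_lift (Pgroup_coef g))).

Lemma Pchar_monoid_morphism g : monoid_morphism (Pchar g).
Proof. exact: P_lift_monoid_morphism. Qed.

Lemma PcharU g m : Pchar g << m >> = mon_eval (Pgroup_coef g) m.
Proof. exact: P_liftU. Qed.

Lemma PcharM g (x y : mon) :
  Pchar g << mmul x y >> = Pchar g << x >> * Pchar g << y >>.
Proof.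
apply: etrans (PcharU g (mmul x y)) _.
by rewrite mon_evalM; congr (_ * _); rewrite PcharU.
Qed.

(** P (x) P is the monoid algebra on pairs of monomials, and the value on a
    pair is a product of two multiplicative functions. *)
Lemma dual_tens_monoid_morphism g h :
  monoid_morphism (dual_tens (Pchar g) (Pchar h)).
Proof.
apply: mlin_monoid_morphism => [|x y].
  by rewrite -[RHS]mulr1; congr (_ * _); apply: (Pchar_monoid_morphism _).1.
rewrite -[RHS]mulrACA; congr (_ * _).
  exact: PcharM.
exact: PcharM.
Qed.

Lemma Pchar_one : Pchar 1%g = dual_one A.
Proof.
apply: dualP; apply: linear_malg_ext; try exact: linearP.
move=> m; rewrite PcharU /= /P_counit mcoeffU1.
case: (eqVneq m mone) => [->|m1]; first by rewrite mon_eval1 scale1r.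
rewrite scale0r; apply/eqP; rewrite /mon_eval.
have [i im] : exists i, i \in finsupp m.
  apply/fset0Pn; apply: contraNneq m1 => m0; apply/eqP/eqP/cmP => i.
  by apply/eqP; rewrite cm1 cmE_eq0 m0.
rewrite (big_fsetD1 i) //= Pgroup_coef_one expr0n cmE_eq0 im.
by rewrite mul0r.
Qed.

(** Both sides are algebra morphisms, and on x_n the equality is the formula for
    the coefficients of a composite. *)
Lemma Pchar_mul g h : Pchar (g * h)%g = dual_mul (Pchar g) (Pchar h).
Proof.
apply: dualP => a.
have phiL := dual_linear (dual_tens (Pchar g) (Pchar h)).
have phiM := dual_tens_monoid_morphism g h.
apply: etrans (esym (P_lift_comp _ phiL phiM a)).
apply: (eq_P_lift (v := Pgroup_coef (g * h)%g)) => n.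
apply: etrans (esym (dual_tens_coprodE _ _ _ _ _ _ _ _ _)).
have xE k g' : Pchar g' (xvar p k) = Pgroup_coef g' k.
  exact: P_lift_xvar (Pgroup_coef0 g').
have x1 g' : Pchar g' 1 = 1 by exact: (Pchar_monoid_morphism g').1.
have xX k l g' : Pchar g' (xvar p k ^+ l) = Pgroup_coef g' k ^+ l.
  apply: etrans (rmorphXn (P_lift (Pgroup_coef g')) l _) _.
  by congr (_ ^+ l); exact: xE.
transitivity (Pgroup_coef g n.+1 * 1 + 1 * Pgroup_coef h n.+1 +
    \sum_(1 <= k < n.+1) Pgroup_coef g k * Pgroup_coef h (n.+1 - k) ^+ (p ^ k)).
  rewrite Pgroup_coefM.
  rewrite -(big_mkord predT (fun k =>
    Pgroup_coef g k * Pgroup_coef h (n.+1 - k) ^+ (p ^ k))).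
  (* The terms k = 0 and k = n.+1 are the primitive part of the coproduct. *)
  rewrite big_ltn // big_nat_recr //= subn0 subnn !Pgroup_coef0 expr1n !mul1r.
  by rewrite !mulr1 expn0 expr1 addrA addrC addrA.
congr (_ * _ + _ * _ + _); try by apply/esym.
by apply: eq_bigr => k _; congr (_ * _); apply/esym.
Qed.

(** The generic series specializes to g, hence its inverse to that of g. *)
Lemma Pchar_inv g : Pchar g^-1%g = dual_antipode p_pr (Pchar g).
Proof.
apply: dualP => a.
have phiM := Pchar_monoid_morphism g.
apply: etrans (esym (P_lift_comp _ (dual_linear _) phiM a)).
apply: (eq_P_lift (v := Pgroup_coef g^-1%g)) => n.
pose f k := iota (sval g k).
apply: (@etrans _ _ (inv_coefs p f n.+1)`_n.+1).
  apply: etrans (esym (rmorph_inv_coefs (f := sval g) _ _ _)) => //.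
  by congr (iota _); exact: series_inv_pow.
have fE k : f (p ^ k)%N = P_lift (Pgroup_coef g) (generic_series p (p ^ k)).
  rewrite /generic_series pfactorK // eqxx.
  exact/esym/(P_lift_xvar _ (Pgroup_coef0 g)).
have E := @rmorph_inv_coefs p {malg 'F_p[mon]} A (P_lift (Pgroup_coef g))
  (generic_series p) f fE n.+1 n.+1.
have S := series_inv_pow (pchar_P p_pr) (generic_series p) n.+1.
apply: etrans E _.
apply: (congr1 (P_lift (Pgroup_coef g))).
exact: (esym S).
Qed.

End Characters.

(** * Linear independence of the characters *)

(** Dedekind's argument, by induction on the number of characters: the relation
    at m0 * m minus chi i m0 times the relation at m no longer involves i, and
    chi j keeps a nonzero coefficient times c j when m0 separates i and j. *)
Lemma sum_characters_eq0 (D : idomainType) (M : monomType) (I : eqType)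
    (chi : I -> M -> D) :
  injective chi -> (forall i, chi i mone = 1) ->
  (forall i, {morph chi i : x y / mmul x y >-> x * y}) ->
  forall (s : seq I) (c : I -> D), uniq s ->
    (forall m, \sum_(i <- s) c i * chi i m = 0) -> {in s, forall i, c i = 0}.
Proof.
move=> chi_inj chi1 chiM; elim=> // i s IH c /= /andP[i_s s_uniq] c0.
have c_s : {in s, forall j, c j = 0}.
  move=> j js; have ij : j != i by apply: contraNneq i_s => <-.
  have [m0 chi_m0] : exists m0, chi j m0 != chi i m0.
    apply: contrapT => chi_eq; case/eqP: ij; apply: chi_inj; apply/funext => m.
    by apply/eqP/negPn/negP => ne; apply: chi_eq; exists m.
  apply/eqP; have /eqP : c j * (chi j m0 - chi i m0) = 0.
    apply: (IH (fun l => c l * (chi l m0 - chi i m0))) => // m.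
    transitivity ((\sum_(l <- i :: s) c l * chi l (mmul m0 m)) -
        chi i m0 * \sum_(l <- i :: s) c l * chi l m); last first.
      by rewrite !c0 mulr0 subr0.
    rewrite !big_cons mulrDr [chi i m0 * (c i * _)]mulrCA chiM opprD addrACA.
    rewrite subrr add0r mulr_sumr -sumrB; apply: eq_bigr => l _.
    by rewrite chiM mulrBr mulrBl mulrA [chi i m0 * _]mulrCA mulrA.
  by rewrite mulf_eq0 subr_eq0 (negPf chi_m0) orbF.
have := c0 mone; rewrite big_cons chi1 mulr1 big_seq big1 ?addr0 => [ci|j js].
  by move=> j; rewrite inE => /predU1P[->|/c_s].
by rewrite c_s // mul0r.
Qed.

(** * Interpolation at points with invertible differences *)

Section Interpolation.
Variables (A : comUnitRingType) (q : nat -> A).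
Hypothesis qP : forall i j, i != j -> q i - q j \is a GRing.unit.

(** The weights are the entries of the inverse of a Vandermonde matrix, so that
    the values at d of the points q_t recover each coefficient of a polynomial of
    degree less than d. *)
Lemma coefficient_functionals (d : nat) : exists w : 'I_d -> 'I_d -> A,
  forall e e' : 'I_d, \sum_(t < d) w e t * q t ^+ e' = (e' == e)%:R.
Proof.
pose V := Vandermonde d (\row_(j < d) q j).
have V_unit : V \in unitmx.
  rewrite unitmxE det_Vandermonde rpred_prod // => i _.
  rewrite rpred_prod // => j ij.
  by rewrite !mxE; apply: qP; rewrite gtn_eqF.
exists (fun e t => invmx V t e) => e e'.
transitivity ((V *m invmx V) e' e); last by rewrite mulmxV // mxE.
by rewrite mxE; apply: eq_bigr => t _; rewrite !mxE mulrC.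
Qed.

(** The version in n variables, on the grid of points with coordinates among the
    q_t: the weights are products of one-variable weights, and the sum over the
    grid factors. *)
Lemma monomial_functionals (n d : nat) (e : 'I_n -> 'I_d) :
  exists c : {ffun 'I_n -> 'I_d} -> A, forall e' : 'I_n -> 'I_d,
    \sum_t c t * \prod_i q (t i) ^+ e' i = [forall i, e' i == e i]%:R.
Proof.
have [w wP] := coefficient_functionals d.
exists (fun t => \prod_i w (e i) (t i)) => e'.
under eq_bigr => t _ do rewrite -big_split /=.
rewrite -(bigA_distr_bigA (fun i t => w (e i) t * q t ^+ e' i)) /=.
under eq_bigr => i _ do rewrite wP.
have [/forallP ee'|/forallPn[i ne]] := boolP [forall i, e' i == e i].
  by rewrite big1 // => i _; rewrite ee'.
by rewrite (bigD1 i) //= (negPf ne) mul0r.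
Qed.

End Interpolation.

(** * The map from the group algebra *)

Section GroupAlgebraMap.
Variables (p : nat) (p_pr : prime p) (A : comAlgType 'F_p) (Q : comNzRingType).
Variables (pQ : p \in [pchar Q]) (iota : {rmorphism Q -> A}).
Local Notation G := (Pgroup pQ).

Definition galg_dual : {malg A[G]} -> dual A mon :=
  mlin (Pchar iota (pQ := pQ)).

HB.instance Definition _ := GRing.Linear.on galg_dual.

Lemma galg_dualU g : galg_dual << g >> = Pchar iota g.
Proof. exact: mlinU. Qed.

Lemma galg_dualE a u :
  galg_dual a u = \sum_(g <- msupp a) a@_g * Pchar iota g u.
Proof. exact: (dual_sumE _ _ _ u). Qed.

Lemma galg_dual_hopf : hopf_morphism p_pr galg_dual.
Proof.
split.
- by rewrite /galg_one galg_dualU Pchar_one.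
(* Both sides are bilinear: reduce to group elements in a, then in b. *)
- move=> a b; move: a; apply: linear_malg_ext => [c a a'|c a a'|g].
  + by rewrite /galg_mul !linearP.
  + rewrite linearP /dual_mul dual_tens_linearl; exact: dualP.
  rewrite /galg_mul mlinU.
  move: b; apply: linear_malg_ext => [c b b'|c b b'|h].
  + by rewrite !linearP.
  + rewrite linearP /dual_mul dual_tens_linearr; exact: dualP.
  by rewrite mlinU !galg_dualU Pchar_mul.
- apply: (linear_malg_ext (V := A^o)) => [c a a'|c a a'|g].
  + by rewrite linearP.
  + by rewrite /galg_counit linearP.
  rewrite /galg_counit mlinU galg_dualU /dual_counit.
  exact: (Pchar_monoid_morphism iota g).1.
- apply: linear_malg_ext => [c a a'|c a a'|g].
  + rewrite linearP; exact: dualP.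
  + by rewrite /galg_coprod !linearP.
  rewrite /galg_coprod !mlinU !galg_dualU.
  apply: dualP; apply: linear_malg_ext; try exact: linearP.
  case=> x y; rewrite dual_tensU -PcharM.
  by congr (Pchar iota g _); exact: mlinU.
- apply: linear_malg_ext => [c a a'|c a a'|g].
  + by rewrite /galg_antipode !linearP.
  + rewrite linearP; exact: dualP.
  by rewrite /galg_antipode mlinU !galg_dualU Pchar_inv.
Qed.

End GroupAlgebraMap.

(** * Elements of P(Q) with prescribed coefficients *)

Section PrescribedCoefficients.
Variables (p : nat) (p_pr : prime p) (Q : comNzRingType) (pQ : p \in [pchar Q]).

Definition series_of_coefs (c : nat -> Q) : nat -> Q := fun n =>
  let i := logn p n in
  if n == (p ^ i)%N then if i is j.+1 then c j else 1 else 0.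

Lemma series_of_coefsP c : p_series p (series_of_coefs c).
Proof.
split=> [|n]; rewrite /series_of_coefs; first by rewrite logn1 expn0 eqxx.
case: (eqVneq n (p ^ logn p n)%N) => [nE _|_]; first by exists (logn p n).
by rewrite eqxx.
Qed.

Definition Pgroup_of_coefs c : Pgroup pQ := exist _ _ (series_of_coefsP c).

Lemma Pgroup_of_coefsE c n : sval (Pgroup_of_coefs c) (p ^ n.+1)%N = c n.
Proof. by rewrite /= /series_of_coefs pfactorK // eqxx. Qed.

End PrescribedCoefficients.

(** * Injectivity and density *)

Lemma mon_eval_ord (p : nat) (A : comAlgType 'F_p) (v : nat -> A) (m : mon) n :
  (forall i, i \in finsupp m -> (i < n)%N) ->
  mon_eval v m = \prod_(i < n) v i.+1 ^+ m i.
Proof.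
move=> mn; rewrite -(big_mkord xpredT (fun i => v i.+1 ^+ m i)).
rewrite /index_iota subn0.
rewrite [RHS](bigID (fun i => i \in finsupp m)) /= [X in _ * X]big1 ?mulr1.
  rewrite -[RHS]big_filter; apply: perm_big; apply: uniq_perm.
  - exact: fset_uniq.
  - by rewrite filter_uniq ?iota_uniq.
  move=> i; rewrite mem_filter mem_iota /= add0n.
  by case: (boolP (i \in finsupp m)) => //= /mn ->.
by move=> i im; move: im; rewrite -cmE_eq0 => /eqP ->; rewrite expr0.
Qed.

Lemma fset_mon_bound (d : {fset mon}) : exists n k : nat, forall m, m \in d ->
  (forall i, i \in finsupp m -> (i < n)%N) /\ (forall i, (m i < k)%N).
Proof.
have maxE (K : choiceType) (e : {fset K}) (F : K -> nat) x : x \in e ->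
    (F x <= \max_(y <- e) F y)%N by move=> xe; apply: leq_bigmax_seq.
exists (\max_(m <- d) \max_(i <- finsupp m) i).+1.
exists (\max_(m <- d) \max_(i <- finsupp m) m i).+1 => m md; split=> i.
  move=> im; rewrite ltnS; apply: leq_trans (maxE _ _ _ _ md).
  exact: (maxE _ _ id).
have [->//|] := eqVneq (m i) 0%N; rewrite cmE_neq0 => im.
by rewrite ltnS; apply: leq_trans (maxE _ _ _ _ md); exact: (maxE _ _ m).
Qed.

Lemma sum_fset_delta (A : nzRingType) (K : choiceType) (d : {fset K})
    (F : K -> A) x : x \in d -> \sum_(y <- d) F y * (x == y)%:R = F x.
Proof.
move=> xd; rewrite (big_fsetD1 x xd) /= eqxx mulr1 big_seq big1 ?addr0 // => y.
by rewrite !inE => /andP[yx _]; rewrite eq_sym (negPf yx) mulr0.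
Qed.

Section InjectivityDensity.
Variables (p : nat) (p_pr : prime p) (R : idomainType) (pR : p \in [pchar R]).
Variables (Q : comNzRingType) (pQ : p \in [pchar Q]).
Local Notation A := (pPrimeCharType pR).
Variable iota : {rmorphism Q -> A}.
Local Notation G := (Pgroup pQ).

(** The points of P are characters of the monoid of monomials; they are distinct
    because the value on the variable n is the coefficient of x^(p^(n+1)). *)
Lemma galg_dual_inj : injective iota -> injective (@galg_dual p A Q pQ iota).
Proof.
move=> iota_inj; apply: raddf_inj => a a0; apply/malgP => g; rewrite mcoeff0.
have [ga|] := boolP (g \in msupp a); last exact: mcoeff_outdom.
pose chi (h : G) (m : mon) : A := mon_eval (Pgroup_coef iota h) m.
apply: (@sum_characters_eq0 A mon G chi _ _ _ (msupp a) (mcoeff^~ a)) ga => //.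
- move=> h h' hh'; apply: (Pgroup_coef_inj iota_inj) => n.
  have := congr1 (@^~ (ucm n)) hh'; rewrite /chi -!P_liftU.
  by rewrite !P_lift_ucm.
- by move=> h; apply: mon_eval1.
- by move=> h; apply: mon_evalM.
- exact: fset_uniq.
move=> m; have := congr1 (fun f : dual A mon => f << m >>) a0.
rewrite galg_dualE => am; apply: etrans am.
by apply: eq_bigr => h _; congr (_ * _); rewrite PcharU.
Qed.

Hypothesis DS : exists q : nat -> Q,
  forall i j, i != j -> (iota (q i) - iota (q j)) \is a GRing.unit.

(** The combination of group elements is the interpolation formula on the grid;
    a grid point t is the series with first n coefficients q_(t 0), ...,
    q_(t (n-1)). *)
Lemma galg_dual_delta (d : {fset mon}) m0 : m0 \in d ->
  exists a : {malg A[G]}, forall m, m \in d ->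
    galg_dual iota a << m >> = (m == m0)%:R.
Proof.
have [q qP] := DS; have [n [k nkP]] := fset_mon_bound d.
move=> m0d; have expn m (md : m \in d) :
    {e : 'I_n -> 'I_k | forall i, e i = m i :> nat}.
  by exists (fun i : 'I_n => Ordinal ((nkP m md).2 i)).
have [e0 e0E] := expn _ m0d.
have [c cP] := monomial_functionals qP e0.
pose g (t : {ffun 'I_n -> 'I_k}) : G := Pgroup_of_coefs pQ
  (fun i => if insub i is Some i' then q (t i') else 0).
exists (\sum_t c t *: << g t >>) => m md; have [e eE] := expn _ md.
rewrite linear_sum /=.
under eq_bigr => t _ do rewrite linearZ /= galg_dualU.
rewrite dual_sumE.
transitivity (\sum_t c t * \prod_i iota (q (t i)) ^+ e i).
  apply: eq_bigr => t _; congr (_ * _); rewrite PcharU.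
  rewrite (mon_eval_ord _ (nkP m md).1); apply: eq_bigr => i _.
  rewrite eE /Pgroup_coef Pgroup_of_coefsE //.
  by case: insubP => [j _ /val_inj ->|]; rewrite ?ltn_ord.
rewrite cP; congr (_%:R); congr nat_of_bool.
apply/forallP/eqP => [ee0|mm0 i]; last first.
  by apply/eqP/val_inj; rewrite /= eE e0E mm0.
apply/eqP/cmP => i; have [ni|ni] := ltnP i n.
  by have := eE (Ordinal ni); rewrite (eqP (ee0 _)) e0E.
(* Beyond n, no monomial of d involves the variable i. *)
have m'0 m' : m' \in d -> m' i = 0%N.
  move=> m'd; apply/eqP; rewrite cmE_eq0; apply: contraTN ni => im.
  by rewrite -ltnNge (nkP _ m'd).1.
by rewrite !m'0.
Qed.

(** A neighbourhood of f contains every functional that agrees with f on some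
    finite set d of monomials. *)
Lemma galg_dual_dense : dense (range (@galg_dual p A Q pQ iota)).
Proof.
move=> O [f Of] Oopen.
have [W [/free_finite_rank_sub [d Wd] WO]] : dual_nbhs f O.
  exact: (open_nbhs_nbhs (conj Oopen Of)).
have /choice [a aP] : forall m0, exists a : {malg A[G]}, m0 \in d ->
    forall m, m \in d -> galg_dual iota a << m >> = (m == m0)%:R.
  move=> m0; have [m0d|] := boolP (m0 \in d); last by exists 0.
  by have [a aP] := galg_dual_delta m0d; exists a.
pose b := \sum_(m0 <- d) f << m0 >> *: a m0.
exists (galg_dual iota b); split; last by exists b.
apply: WO; exists (galg_dual iota b - f); last by rewrite addrC subrK.
move=> w /Wd wd; rewrite /dual_ext /mlin big_seq big1 // => m mw.
have md := fsubsetP wd _ mw.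
rewrite -[_ *: _]/(w@_m * (galg_dual iota b << m >> - f << m >>)).
apply/eqP; rewrite mulf_eq0 subr_eq0; apply/orP; right; apply/eqP.
rewrite linear_sum.
under eq_bigr => m0 _ do rewrite linearZ /=.
rewrite dual_sumE.
transitivity (\sum_(m0 <- d) f << m0 >> * (m == m0)%:R).
  by apply: eq_big_seq => m0 m0d; congr (_ * _); apply: aP.
exact: (sum_fset_delta (fun m0 => f << m0 >>) md).
Qed.

End InjectivityDensity.

Theorem proposition5p3 (p : nat) (p_pr : prime p) (R : idomainType)
    (S : {pred R}) (Q : GRing.SubComNzRing.type S)
    (DS : DS_extension Q) (pcharQ : p \in [pchar Q]) :
  let A := pPrimeCharType (pchar_ambient pcharQ) in
  exists Phi : {linear {malg A[Pgroup pcharQ]} -> dual A {cmonom nat}},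
    [/\ injective Phi, hopf_morphism p_pr Phi & dense (range Phi)].
Proof.
move=> A; pose iota : {rmorphism Q -> A} := (val : {rmorphism Q -> R}).
exists (@galg_dual p A Q pcharQ iota); split.
- by apply: galg_dual_inj; exact: val_inj.
- exact: galg_dual_hopf.
- by have [q qP] := DS; apply: galg_dual_dense => //; exists q => i j /qP.
Qed.
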